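(* For all integers $k \geq 1$ and $n\ge 1$, $$2^{2k-1} S_{2k-1}(n) = \sum_{m=1}^k R(k,m)\, \frac{F_m(n)}{m}, \qquad\text{where}\qquad F_m(n) = \sum_{i=1}^n \binom{2i+m-1}{2m-1}.$$
   Context: For integers $k, n\ge 1$, $S_k(n) = 1^k + 2^k + \cdots + n^k$. For integers $0 \le m \le k$, the numbers $R(k,m)$ (OEIS A304330) are defined by $$R(k,m) = \sum_{j=0}^m (-1)^j \binom{2m}{j} (m-j)^{2k},$$ with the convention $0^0=1$. Binomial coefficients $\binom{a}{b}$ with integers $0\le a<b$ are $0$. *)

(* Defs.v *)
From mathcomp Require Import all_boot all_order all_algebra.
Set Implicit Arguments.
Unset Strict Implicit.
Unset Printing Implicit Defensive.
Import GRing.Theory Num.Theory.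
Local Open Scope ring_scope.

Definition power_sum (k n : nat) : nat := (\sum_(1 <= i < n.+1) i ^ k)%N.

(* OEIS A304330; here 0 ^+ 0 = 1. *)
Definition R_coef (k m : nat) : int :=
  \sum_(0 <= j < m.+1)
    (-1) ^+ j * ('C(2 * m, j))%:Z * (m%:Z - j%:Z) ^+ (2 * k).

(* For 1 <= m, the only case of interest, neither natural-number subtraction
   truncates. *)
Definition F_sum (m n : nat) : nat :=
  (\sum_(1 <= i < n.+1) 'C(2 * i + m - 1, 2 * m - 1))%N.

(* Main.v *)
Require Import Defs.
From mathcomp Require Import all_boot all_order all_algebra.
From mathcomp Require Import zify ring.
Import GRing.Theory Num.Theory.
Local Open Scope ring_scope.

(** The sum over [i] is a red herring: the identity already holds term by term,
    as [x ^ (2k-1) = \sum_(1 <= m <= k) R(k,m) * 'C(x+m-1, 2m-1) / m] for every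
    natural number [x] and every [k >= 1], and the theorem is the sum of the cases [x = 2i].

    The numbers [R(k,m)] are, up to the factor [(2m)!/2], the central factorial
    numbers, and ['C(x+m-1, 2m-1)/m] is, up to the inverse factor, the odd
    central factorial [x * \prod_(1 <= j < m) (x^2 - j^2)]. So the termwise
    identity expands a monomial in central factorials, and it follows by
    induction on [k] from two recurrences: multiplying the [m]-th central
    factorial by [x^2 - m^2] gives the next one ([central_binS]), and [R]
    satisfies the matching triangular recurrence ([R_coef_rec]). The induction
    closes because [R(k,m)] vanishes for [m > k >= 1] ([R_coef_gt]). Since [R] is
    only half of a full central difference, this vanishing fails in the row
    [k = 0], and the row [k = 1] has to be computed from partial alternating
    sums of binomial coefficients. *)

(** This comes from [(m-j)^2 = m^2 - j (2m-j)]: absorbing the factors [j] and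
    [2m-j] into the binomial coefficient lowers its upper index by two, and the
    shift of [j] by one then turns the sum into that of [R_coef k (m-1)]. *)
Lemma R_coef_rec (k m : nat) :
  R_coef k.+1 m.+1 =
  m.+1%:Z ^+ 2 * R_coef k m.+1 + (2 * m.+1 * (2 * m).+1)%N%:Z * R_coef k m.
Proof.
have absorb j : (j.+1 * (2 * m + 1 - j) * 'C(2 * m.+1, j.+1) =
                 2 * m.+1 * (2 * m).+1 * 'C(2 * m, j))%N.
  have diag := mul_bin_diag (2 * m).+2 j; have down := mul_bin_down (2 * m).+1 j.
  have -> : (2 * m.+1 = (2 * m).+2)%N by lia.
  have -> : (2 * m + 1 - j = (2 * m).+1 - j)%N by lia.
  by rewrite mulnAC -diag -mulnA [X in (_ * X)%N]mulnC -down mulnA.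
rewrite /R_coef !(big_nat_recl m.+1) // mulrDr -addrA.
congr (_ + _).
  by rewrite subr0 (_ : (2 * k.+1 = 2 + 2 * k)%N) ?exprD; [ring | lia].
rewrite !big_distrr -big_split /=.
apply: eq_big_nat => j /andP[_ ltjm].
have /(congr1 Posz) := absorb j; rewrite !PoszM => absorbZ.
have sqE : (m.+1%:Z - j.+1%:Z) ^+ 2 =
           m.+1%:Z ^+ 2 - j.+1%:Z * (2 * m + 1 - j)%N%:Z.
  by rewrite -subzn; lia.
have shiftE : m.+1%:Z - j.+1%:Z = m%:Z - j%:Z by lia.
rewrite (_ : (2 * k.+1 = 2 + 2 * k)%N); last by lia.
rewrite exprD sqE shiftE exprS.
set e := (-1) ^+ j; set d := (m%:Z - j%:Z) ^+ _.
set J := j.+1%:Z * _ in absorbZ *.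
transitivity (- e * d * m.+1%:Z ^+ 2 * ('C(2 * m.+1, j.+1))%:Z
              + e * d * (J * ('C(2 * m.+1, j.+1))%:Z)); first by ring.
by rewrite absorbZ; ring.
Qed.

Lemma R_coefS0 (k : nat) : R_coef k.+1 0 = 0.
Proof. by rewrite /R_coef big_nat1 subrr expr0n muln_eq0 mulr0. Qed.

Lemma sum_alternating_bin (n m : nat) :
  \sum_(0 <= j < m.+1) (-1) ^+ j * ('C(n.+1, j))%:Z = (-1) ^+ m * ('C(n, m))%:Z.
Proof.
elim: m => [|m IHm]; first by rewrite big_nat1 !bin0.
by rewrite big_nat_recr //= IHm binS PoszD exprS; ring.
Qed.

Lemma R_coef0S (m : nat) : R_coef 0 m.+1 = (-1) ^+ m.+1 * ('C((2 * m).+1, m.+1))%:Z.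
Proof.
rewrite -sum_alternating_bin /R_coef (_ : (2 * m.+1 = (2 * m).+2)%N); last by lia.
by apply: eq_bigr => j _; rewrite muln0 expr0 mulr1.
Qed.

Lemma R_coef11 : R_coef 1 1 = 1.
Proof. by rewrite /R_coef unlock. Qed.

(** By the recurrence, an entry of row 1 is a combination of two entries of row 0,
    which are halves of consecutive central binomial coefficients; they cancel
    from the third column on. *)
Lemma R_coef1_gt1 (m : nat) : R_coef 1 m.+2 = 0.
Proof.
rewrite R_coef_rec !R_coef0S.
have binE : (m.+2 * 'C((2 * m.+1).+1, m.+2) =
             2 * (2 * m.+1).+1 * 'C((2 * m).+1, m.+1))%N.
  rewrite -mul_bin_diag (_ : (2 * m.+1 = (2 * m).+2)%N); last by lia.
  have symE : 'C((2 * m).+1, m) = 'C((2 * m).+1, m.+1).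
    by rewrite -bin_sub; [congr 'C(_, _); lia | lia].
  by rewrite succnK (binS (2 * m).+1) symE; lia.
have /(congr1 Posz) := binE; rewrite !PoszM => binZ.
rewrite (exprS _ m.+1).
set e := (-1) ^+ m.+1.
transitivity (e * m.+2%:Z * (2%:Z * (2 * m.+1).+1%:Z * ('C((2 * m).+1, m.+1))%:Z
   - m.+2%:Z * ('C((2 * m.+1).+1, m.+2))%:Z)); first by ring.
by rewrite binZ subrr mulr0.
Qed.

Lemma R_coef_gt (k m : nat) : (k.+1 < m)%N -> R_coef k.+1 m = 0.
Proof.
elim: k m => [|k IHk] [|m] // ltkm; first by case: m ltkm => // m _; apply: R_coef1_gt1.
by rewrite R_coef_rec !IHk ?mulr0 //; lia.
Qed.

(** Up to the factor [2/(2m+2)!], this is the central factorial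
    [x * \prod_(1 <= j <= m) (x^2 - j^2)]; counting from zero avoids the
    subtractions in ['C(x+m-1, 2m-1)/m]. *)
Definition central_bin (x m : nat) : rat := ('C(x + m, (2 * m).+1))%:R / m.+1%:R.

Lemma central_binS (x m : nat) :
  (x%:R ^+ 2 - m.+1%:R ^+ 2) * central_bin x m =
  (2 * m.+2 * (2 * m.+1).+1)%:R * central_bin x m.+1.
Proof.
rewrite /central_bin.
have nz_m1 : m.+1%:R != 0 :> rat by rewrite pnatr_eq0.
have nz_m2 : m.+2%:R != 0 :> rat by rewrite pnatr_eq0.
(* Below [m.+1] both binomial coefficients vanish; above, the subtraction
   [x - m.+1] of natural numbers in [binE] is exact. *)
have [ltxm|lemx] := ltnP x m.+1.
  by rewrite !bin_small ?mul0r ?mulr0 //; lia.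
have binE : ((2 * m.+1).+1 * (2 * m.+1) * 'C(x + m.+1, (2 * m.+1).+1) =
             (x + m.+1) * (x - m.+1) * 'C(x + m, (2 * m).+1))%N.
  have diag := mul_bin_diag (x + m).+1 (2 * m.+1).
  have := mul_bin_left (x + m) (2 * m).+1.
  rewrite (_ : (2 * m).+2 = (2 * m.+1)%N); last by lia.
  rewrite (_ : (x + m - (2 * m).+1 = x - m.+1)%N); last by lia.
  by move=> left; rewrite mulnAC addnS -diag -mulnA [X in (_ * X)%N]mulnC left mulnA.
have /(congr1 (fun a => a%:R : rat)) := binE.
rewrite !natrM natrD natrB // => binQ.
apply: (mulIf nz_m1).
rewrite /= -[LHS]mulrA divfK // subr_sqr [X in X * _ = _]mulrC -binQ.
rewrite -[in LHS](divfK nz_m2 'C(x + m.+1, (2 * m.+1).+1)%:R).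
by ring.
Qed.

(** The expansion of an odd power in central factorials. In the inductive step,
    [x^2] times the [m]-th central factorial splits into a multiple of itself
    and a multiple of the next one, which are the two terms of [R_coef_rec]
    after a shift of index; the boundary terms of the shift vanish. *)
Lemma odd_power_expansion (x k : nat) :
  x%:R ^+ (2 * k).+1 =
  \sum_(0 <= m < k.+1) (R_coef k.+1 m.+1)%:~R * central_bin x m.
Proof.
elim: k => [|k IHk].
  by rewrite big_nat1 R_coef11 /central_bin addn0 bin1 expr1 divr1 mul1r.
rewrite (_ : (2 * k.+1).+1 = (2 + (2 * k).+1)%N) ?exprD; last by lia.
rewrite IHk big_distrr /=.
under eq_bigr => m _.
  rewrite (_ : _ * _ = m.+1%:R ^+ 2 * (R_coef k.+1 m.+1)%:~R * central_bin x m
    + (2 * m.+2 * (2 * m.+1).+1)%:R * (R_coef k.+1 m.+1)%:~R * central_bin x m.+1).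
    over.
  rewrite -[in X in _ + X]mulrA [in X in _ + X]mulrCA -central_binS; ring.
under [RHS]eq_bigr => m _ do
  rewrite R_coef_rec intrD (intrM _ (_ ^+ 2)) rmorphXn (intrM _ (Posz _)) /=
          -!pmulrn mulrDl.
rewrite !big_split /=; congr (_ + _).
  by rewrite [RHS]big_nat_recr //= R_coef_gt // mulr0 mul0r addr0.
by rewrite [RHS]big_nat_recl //= R_coefS0 mulr0 mul0r add0r.
Qed.

Theorem mainTheorem7 (k n : nat) (hk : (1 <= k)%N) (hn : (1 <= n)%N) :
  2 ^+ (2 * k - 1) * (power_sum (2 * k - 1) n)%:R =
  \sum_(1 <= m < k.+1) (R_coef k m)%:~R * ((F_sum m n)%:R / m%:R) :> rat.
Proof.
case: k hk => // k _.
rewrite (_ : (2 * k.+1 - 1 = (2 * k).+1)%N); last by lia.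
rewrite [RHS]big_add1 /power_sum natr_sum big_distrr /=.
transitivity (\sum_(1 <= i < n.+1) \sum_(0 <= m < k.+1)
                (R_coef k.+1 m.+1)%:~R * central_bin (2 * i) m).
  by apply: eq_bigr => i _; rewrite -odd_power_expansion natrM exprMn natrX.
rewrite exchange_big /=; apply: eq_bigr => m _.
rewrite -big_distrr /F_sum natr_sum big_distrl /=; congr (_ * _).
apply: eq_bigr => i _; rewrite /central_bin.
by congr (('C(_, _))%:R / _); lia.
Qed.
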